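(* Let $G\in\mathbb{R}^{n\times n}$ be the pseudogradient matrix of the $N$-player linear-quadratic game described in the context, with shared constraints $Ax\le b$, $Ex=f$, where $A\in\mathbb{R}^{m\times n}$ and $E\in\mathbb{R}^{q\times n}$. Let $W\subseteq\{1,\dots,m\}$ be any index set, let $A_W\in\mathbb{R}^{|W|\times n}$ be the rows of $A$ indexed by $W$, and let $$\bar A_W=\begin{bmatrix}A_W\\ E\end{bmatrix}\in\mathbb{R}^{(|W|+q)\times n}.$$ If $\bar A_W$ has full row rank and the symmetric part $G_s=\tfrac12(G+G^\top)$ is positive definite, then the matrix $$\bar S_W=\bar A_W\,G^{-1}\bar A_W^\top\in\mathbb{R}^{(|W|+q)\times(|W|+q)}$$ is invertible.
   Context: Consider an $N$-player game in which player $i\in\{1,\dots,N\}$ has decision vector $x_i\in\mathbb{R}^{n_i}$, with $x=(x_1,\dots,x_N)\in\mathbb{R}^n$ and $n=\sum_{i=1}^N n_i$. Player $i$ minimizes over $x_i$ the cost $\tfrac12 x^\top Q^{(i)}x+(c^{(i)})^\top x$ subject to shared constraints $Ax\le b$, $Ex=f$, with $A\in\mathbb{R}^{m\times n}$, $b\in\mathbb{R}^m$, $E\in\mathbb{R}^{q\times n}$, $f\in\mathbb{R}^q$ ($m,q\ge 0$), where $Q^{(i)}\in\mathbb{R}^{n\times n}$ is symmetric, $c^{(i)}\in\mathbb{R}^n$, and the $i$-th diagonal block $Q^{(i)}_{ii}\in\mathbb{R}^{n_i\times n_i}$ is positive definite. The pseudogradient matrix $G\in\mathbb{R}^{n\times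 n}$ is obtained by stacking block rows: the $i$-th block row of $G$ (the $n_i$ rows corresponding to $x_i$) equals the $i$-th block row of $Q^{(i)}$, i.e. $G_{i,:}=Q^{(i)}_{i,:}$ for $i=1,\dots,N$. In general $G$ is not symmetric. When $G_s$ is positive definite, $G$ is invertible, so $G^{-1}$ above is well defined. *)

(* Defs.v *)
From mathcomp Require Import all_boot all_order all_algebra.
From mathcomp Require Import reals.

Set Implicit Arguments.
Unset Strict Implicit.
Unset Printing Implicit Defensive.

Import Order.TTheory GRing.Theory Num.Theory.
Local Open Scope ring_scope.

Definition posdefmx (R : realType) (n : nat) (M : 'M[R]_n) : Prop :=
  M \is symmetricmx /\
  forall x : 'cV[R]_n, x != 0 -> 0 < (x^T *m M *m x) 0 0.

(* Players are indexed by 'I_N and player i controls d i coordinates, so the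
   joint decision space is R^(\sum_i d i), split by the block structure of
   \mxcol and \mxblock. *)
Record lq_game (R : realType) (N : nat) (d : 'I_N -> nat) (m q : nat) :=
  LQGame {
    quad : 'I_N -> 'M[R]_(\sum_(i < N) d i)%N;
    lin : 'I_N -> 'cV[R]_(\sum_(i < N) d i)%N;
    ineq_lhs : 'M[R]_(m, (\sum_(i < N) d i)%N);
    ineq_rhs : 'cV[R]_m;
    eq_lhs : 'M[R]_(q, (\sum_(i < N) d i)%N);
    eq_rhs : 'cV[R]_q;
    quad_sym : forall i, quad i \is symmetricmx;
    quad_posdef : forall i, posdefmx (submxblock (quad i) i i) }.

Section Game.
Variables (R : realType) (N : nat) (d : 'I_N -> nat) (m q : nat).
Variable g : lq_game R d m q.

Definition cost (i : 'I_N) (x : 'cV[R]_(\sum_(i < N) d i)%N) : R :=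
  2^-1 * (x^T *m quad g i *m x) 0 0 + ((lin g i)^T *m x) 0 0.

Definition feasible (x : 'cV[R]_(\sum_(i < N) d i)%N) : Prop :=
  (forall k, (ineq_lhs g *m x) k 0 <= ineq_rhs g k 0) /\
  eq_lhs g *m x = eq_rhs g.

Definition pseudograd_mx : 'M[R]_(\sum_(i < N) d i)%N :=
  \mxcol_(i < N) submxcol (quad g i) i.

Definition working_mx (W : {set 'I_m}) :
    'M[R]_((#|W| + q)%N, (\sum_(i < N) d i)%N) :=
  col_mx (rowsub (fun k : 'I_#|W| => enum_val k) (ineq_lhs g)) (eq_lhs g).

(* invmx M is M itself when M is singular, so this is the intended matrix
   only when the pseudogradient matrix is invertible. *)
Definition schur_mx (W : {set 'I_m}) : 'M[R]_(#|W| + q)%N :=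
  working_mx W *m invmx pseudograd_mx *m (working_mx W)^T.

End Game.

Definition sympart (R : realType) (n : nat) (M : 'M[R]_n) : 'M[R]_n :=
  2^-1 *: (M + M^T).

(* Main.v *)
Require Import Defs.
From mathcomp Require Import all_boot all_order all_algebra.
From mathcomp Require Import reals.

Import Order.TTheory GRing.Theory Num.Theory.

Local Open Scope ring_scope.

(** Call a square matrix, symmetric or not, positive when its quadratic form
    is positive away from zero.  The form does not distinguish a matrix from
    its symmetric part, so the pseudogradient matrix [G] is positive.
    Positivity forces a trivial kernel, hence invertibility
    ([posform_unitmx]), and it is inherited by the inverse
    ([posform_invmx]) and by [B *m M *m B^T] whenever the rows of [B] are
    linearly independent ([posform_congr]).  So [G^-1], then
    [A G^-1 A^T] with [A] the working constraint matrix, are positive, and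
    the latter is invertible. *)

(** Unlike [posdefmx], this must apply to [G] and its inverse, which in general
    are not symmetric; row vectors match the conventions of [row_free] and
    [kermx]. *)
Definition posform {R : numFieldType} {n : nat} (M : 'M[R]_n) : Prop :=
  forall u : 'rV[R]_n, u != 0 -> 0 < (u *m M *m u^T) 0 0.

Lemma quadform_tr {R : numFieldType} {n : nat} (M : 'M[R]_n) (u : 'rV[R]_n) :
  (u *m M^T *m u^T) 0 0 = (u *m M *m u^T) 0 0.
Proof. by rewrite -[RHS]trace_mx11 -mxtrace_tr trace_mx11 !trmx_mul !trmxK mulmxA. Qed.

Lemma posform_sympart {R : realType} {n : nat} (M : 'M[R]_n) :
  posdefmx (sympart M) -> posform M.
Proof.
case=> _ posM u u0.
have /posM : u^T != 0 by rewrite trmx_eq0.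
rewrite trmxK /sympart -scalemxAr -scalemxAl mulmxDr mulmxDl mxE [X in _ * X]mxE.
by rewrite quadform_tr -mulr2n -[X in _ * X]mulr_natl mulKf ?pnatr_eq0.
Qed.

(** A row vector killed by [M] makes the quadratic form vanish, so it is 0. *)
Lemma posform_unitmx {R : numFieldType} {n : nat} (M : 'M[R]_n) :
  posform M -> M \in unitmx.
Proof.
move=> posM; rewrite -row_free_unit -kermx_eq0; apply/eqP/row_matrixP => i.
rewrite row0; apply/eqP/negP => /negP /posM.
by rewrite -row_mul mulmx_ker row0 mul0mx mxE ltxx.
Qed.

(** Writing [u] as [v *m M] turns the form of the inverse at [u] into the form
    of [M^T], equivalently of [M], at [v]. *)
Lemma posform_invmx {R : numFieldType} {n : nat} (M : 'M[R]_n) :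
  posform M -> posform (invmx M).
Proof.
move=> posM u u0; have uM := posform_unitmx _ posM.
have uE : u = u *m invmx M *m M by rewrite mulmxKV.
have v0 : u *m invmx M != 0.
  by apply: contraNneq u0 => v0; rewrite uE v0 mul0mx.
by rewrite [X in _ *m X^T]uE trmx_mul mulmxA quadform_tr posM.
Qed.

Lemma posform_congr {R : numFieldType} {k n : nat} (B : 'M[R]_(k, n))
    (M : 'M[R]_n) :
  row_free B -> posform M -> posform (B *m M *m B^T).
Proof.
move=> freeB posM u u0.
rewrite !mulmxA -[_ *m B^T *m u^T]mulmxA -trmx_mul posM //.
by rewrite mulmx_free_eq0.
Qed.

Theorem lemma4p1 (R : realType) (N : nat) (d : 'I_N -> nat) (m q : nat)
    (g : lq_game R d m q) (W : {set 'I_m}) :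
  row_free (working_mx g W) ->
  posdefmx (sympart (pseudograd_mx g)) ->
  schur_mx g W \in unitmx.
Proof.
move=> freeA posG.
by apply/posform_unitmx/posform_congr/posform_invmx/posform_sympart.
Qed.
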